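(* Consider the problem $\min_{x\in\mathcal H}F(x)=f(x)+\psi(x)$ described in the context. Let $x^*$ be an isolated local minimum of $F$ and let $R>0$ be such that $F(x)\ge F(x^* )$ and $\operatorname{dist}(x,S)=\|x-x^*\|$ for all $x\in B_R(x^* )$. Suppose that for some $L\ge0$ and $\mu>0$: (1) $\|f'(y)-f'(x)-H(x)(y-x)\|_*\le L\|x-y\|$ for all $x,y\in B_R(x^* )$, and the subproblem assumption (see context) holds with this $L$; (2) $\frac1{2\mu}\operatorname{dist}(0,\partial F(x))^2\ge F(x)-F(x^* )$ for all $x\in B_R(x^* )$; (3) $H(x)\succeq\mu I$ for all $x\in B_R(x^* )$; (4) $\frac\mu2\operatorname{dist}(x,S)^2\le F(x)-F(x^* )$ for all $x\in B_R(x^* )$. Suppose additionally that $F$ is convex in a neighbourhood of $x^*$ and that $f'$ is semismooth (Newton differentiable) at $x^*$ with respect to $H$. Then there exists $\Delta>0$ such that the following holds for every starting point $x_0\in B_R(x^* )$ with $\|F'(x_0)\|_*\le\Delta$: if $(x_k)_{k\in\mathbb N}$ are the iterates of the LeAP-SSN algorithm (see context) started at $x_0$, and, writing $x_{k,+}=x_+(\lambda_k/2,x_k)$, either $$\|(H(x_{k,+})-H(x_k))(x_{k,+}-x^* )\|_*=o(\|x_{k,+}-x_k\|)\quad\text{as }k\to\infty$$ or $$\frac{\|f'(x_{k,+})-f'(x_k)-H(x_k)(x_{k,+}-x_k)\|_*}{\|x_{k,+}-x_k\|}\to0\quad\text{as }k\to\infty,$$ then, as $k\to\infty$, $x_k\to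 x^*$ superlinearly, $F(x_k)-F(x^* )\to0$ superlinearly, and $\|F'(x_k)\|_*\to0$ superlinearly.
   Context: Setting. $\mathcal H$ is a real Hilbert space with norm $\|\cdot\|$, dual $\mathcal H^*$ with norm $\|\cdot\|_*$, duality pairing $\langle\cdot,\cdot\rangle$, and Riesz map $\mathcal R:\mathcal H\to\mathcal H^*$. $f\in C^{1,1}(\mathcal H;\mathbb R)$ (Fréchet differentiable with Lipschitz derivative $f'$, possibly nonconvex); $\psi:\mathcal H\to\mathbb R\cup\{+\infty\}$ is proper, convex, lower semicontinuous; $F=f+\psi$ is bounded below with minimal value $F^*$ and the solution set $S=\{x:F(x)=F^*\}$ is nonempty. $\operatorname{dom}F=\{F<+\infty\}$; $\partial\psi$ is the convex subdifferential and $\partial F(x)=f'(x)+\partial\psi(x)$; $\operatorname{dist}(0,\partial F(x))=\inf\{\|g\|_*:g\in\partial F(x)\}$ ($+\infty$ if $\partial F(x)=\emptyset$); $\operatorname{dist}(x,S)=\inf_{u\in S}\|x-u\|$; $B_R(x)$ is the closed ball. To every $x\in\mathcal H$ is associated a symmetric bounded linear operator $H(x):\mathcal H\to\mathcal H^*$; $H(x)\succeq\mu I$ means $\langle H(x)d,d\rangle\ge\mu\|d\|^2$ for all $d\in\mathcal H$. $f'$ is semismooth (Newton differentiable) at $x^*$ with respect to $H$ if $\lim_{h\to0}\|f'(x^*+h)-f'(x^* )-H(x^*+h)h\|_*/\|h\|=0$. Subproblem. For $x\in\operatorname{dom}F$ and $\lambda\ge0$ let $\widetilde F(y;x,\lambda)=f(x)+\langle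 f'(x),y-x\rangle+\frac12\langle H(x)(y-x),y-x\rangle+\frac\lambda2\|y-x\|^2+\psi(y)$. A point $x_+=x_+(\lambda,x)$ is an admissible solution if (FO) $-f'(x)-H(x)(x_+-x)-\lambda\mathcal R(x_+-x)\in\partial\psi(x_+)$ and (D) $\widetilde F(x_+;x,\lambda)\le\widetilde F(x;x,\lambda)=F(x)$. If $H(x)\succeq0$ and $\lambda>0$, $x_+(\lambda,x)$ is the unique minimiser of the strongly convex function $\widetilde F(\cdot;x,\lambda)$. For an admissible solution set $\psi'(x_+)=-f'(x)-H(x)(x_+-x)-\lambda\mathcal R(x_+-x)$ and $F'(x_+)=f'(x_+)+\psi'(x_+)\in\partial F(x_+)$. Subproblem assumption (with constant $L$): for all $\lambda\ge L$ and all $x\in\operatorname{dom}F$ an admissible solution exists (and can be computed). LeAP-SSN algorithm. Input: $m\ge1$, $\alpha\in(0,1/2]$, $\beta\in(0,(m-1)/(2m)]$, $x_0\in\operatorname{dom}F$, $\psi'(x_0)\in\partial\psi(x_0)$, $\Lambda_0>0$; $F'(x_0)=f'(x_0)+\psi'(x_0)$. At iteration $k=0,1,\dots$: for $j=0,1,\dots$, set $\lambda=2^j\Lambda_k$; take an admissible solution $x_+=x_+(\lambda,x_k)$ (if none exists, go to the next $j$); if $$\langle F'(x_+),x_k-x_+\rangle\ge\tfrac\alpha\lambda\|F'(x_+)\|_*^2\quad\text{and}\quad F(x_k)-F(x_+)\ge\beta\lambda\|x_+-x_k\|^2,$$ accept: set $j_k=j$, $x_{k+1}=x_+$, $\lambda_k=\lambda=2^{j_k}\Lambda_k$,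 $\Lambda_{k+1}=\lambda_k/2$, $F'(x_{k+1})=F'(x_+)$ and go to iteration $k+1$; otherwise go to the next $j$. A nonnegative sequence $(a_k)$ converges to $0$ superlinearly if $a_{k+1}\le\varepsilon_ka_k$ for all large $k$ with some $\varepsilon_k\to0$; $x_k\to x^*$ superlinearly means this for $a_k=\|x_k-x^*\|$. Quotients with zero denominator (in which case the numerator vanishes too) are read as $0$. *)

(* Defs.v *)
From mathcomp Require Import all_boot all_order all_algebra.
From mathcomp Require Import all_classical all_reals all_analysis.
Set Implicit Arguments.
Unset Strict Implicit.
Unset Printing Implicit Defensive.
Import Order.TTheory GRing.Theory Num.Theory.
Import numFieldNormedType.Exports.
Local Open Scope classical_set_scope.
Local Open Scope ring_scope.

Section Dual.
Context {R : realType} {V : completeNormedModType R}.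

(* With a compatible positive definite form, V is a real Hilbert space. *)
Definition hilbert_dot (dot : {dot V for @idfun R}) : Prop :=
  forall x : V, `|x| ^+ 2 = dot x x.

(* Elements of the dual space are kept as plain functions V -> R, which carry
   the pointwise vector space structure. *)
Definition dual : set (V -> R) := [set g : V -> R | scalar g /\ continuous g].

(* The supremum is over a bounded set when g is in the dual; for an unbounded
   set, sup returns 0. *)
Definition dual_norm (g : V -> R) : R :=
  sup [set `|g d| | d in [set d : V | `|d| <= 1]].

Definition riesz (dot : {dot V for @idfun R}) (x : V) : V -> R :=
  fun y => dot x y.

Definition grad (f : V -> R) (x : V) : V -> R := 'd f x.

Definition C11 (f : V -> R) : Prop :=
  (forall x, differentiable f x) /\
  exists K : R, forall x y, dual_norm (grad f y - grad f x) <= K * `|y - x|.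

(* A d e stands for <A d, e>. *)
Definition sym_bounded_op (A : V -> V -> R) : Prop :=
  [/\ forall d, dual (A d),
      forall (a : R) d e, A (a *: d + e) = a *: A d + A e,
      exists C : R, forall d, dual_norm (A d) <= C * `|d|
    & forall d e, A d e = A e d].

Definition semismooth_at (f : V -> R) (H : V -> V -> V -> R) (xs : V) : Prop :=
  dual_norm (grad f (xs + h) - grad f xs - H (xs + h) h) / `|h|
    @[h --> 0^'] --> (0 : R).

Definition dist_set (x : V) (A : set V) : R := inf [set `|x - u| | u in A].

End Dual.

Section ExtendedValued.
Context {R : realType} {V : completeNormedModType R}.
Implicit Types (phi : V -> \bar R) (A : set V).
Local Open Scope ereal_scope.

Definition edom phi : set V := [set x | phi x < +oo].

Definition proper_fun phi : Prop := (forall x, -oo < phi x) /\ edom phi !=set0.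

(* Only used for functions that avoid -oo, so that no sum +oo - oo occurs;
   0 * +oo = 0. *)
Definition convex_on A phi : Prop :=
  forall (x y : V) (t : R), A x -> A y -> (0 <= t <= 1)%R ->
    phi (t *: x + (1 - t) *: y)%R <= t%:E * phi x + (1 - t)%:E * phi y.

Definition subdiff phi (x : V) : set (V -> R) :=
  [set g | dual g /\ forall y, phi x + (g (y - x)%R)%:E <= phi y].

(* The value is required to be finite: otherwise every interior point of the
   complement of the domain would be a local minimizer. *)
Definition local_minimizer phi (x : V) : Prop :=
  phi x < +oo /\ \forall y \near x, phi x <= phi y.

Definition isolated_local_minimizer phi (x : V) : Prop :=
  local_minimizer phi x /\
  \forall y \near x, local_minimizer phi y -> y = x.

Definition argmin phi : set V := [set x | phi x = ereal_inf (range phi)].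

End ExtendedValued.

Section Problem.
Context {R : realType} {V : completeNormedModType R}.
Variables (dot : {dot V for @idfun R}) (f : V -> R) (psi : V -> \bar R).
Variable H : V -> V -> V -> R.

Definition objective (x : V) : \bar R := ((f x)%:E + psi x)%E.
Local Notation F := objective.

Definition subdiffF (x : V) : set (V -> R) :=
  [set grad f x + g | g in subdiff psi x].

(* Equals +oo when subdiffF x is empty. *)
Definition dist0_subdiffF (x : V) : \bar R :=
  ereal_inf [set (dual_norm g)%:E | g in subdiffF x].

Definition model (lambda : R) (x y : V) : \bar R :=
  ((f x + grad f x (y - x) + 2^-1 * H x (y - x) (y - x)
    + lambda / 2 * `|y - x| ^+ 2)%:E + psi y)%E.

Definition psi_deriv (lambda : R) (x y : V) : V -> R :=
  - grad f x - H x (y - x) - lambda *: riesz dot (y - x).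

Definition F_deriv (lambda : R) (x y : V) : V -> R :=
  grad f y + psi_deriv lambda x y.

Definition admissible (lambda : R) (x y : V) : Prop :=
  subdiff psi y (psi_deriv lambda x y) /\
  (model lambda x y <= model lambda x x)%E.

Definition subproblem_assumption (L : R) : Prop :=
  forall (lambda : R) (x : V), L <= lambda -> edom F x ->
    exists y, admissible lambda x y.

(* xp lambda x is the solution x_+(lambda, x) that the method uses; its value
   is arbitrary when no admissible solution exists. *)
Definition solution_map (xp : R -> V -> V) : Prop :=
  forall (lambda : R) (x : V), 0 <= lambda -> edom F x ->
    (exists y, admissible lambda x y) -> admissible lambda x (xp lambda x).

(* When there is no admissible solution, lambda is not accepted and the inner
   loop goes on, as it does when one of the two tests fails. *)
Definition accepted (alpha beta : R) (xp : R -> V -> V) (lambda : R) (x : V)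
    : Prop :=
  let y := xp lambda x in
  [/\ admissible lambda x y,
      alpha / lambda * dual_norm (F_deriv lambda x y) ^+ 2
        <= F_deriv lambda x y (x - y)
    & ((beta * lambda * `|y - x| ^+ 2)%:E <= F x - F y)%E].

(* x k, g k and lam k are x_k, psi'(x_k) and lambda_k; Lam k is Lambda_k and
   j k is the first accepted index j_k of the inner loop. *)
Definition leap_ssn_iterates (alpha beta Lam0 : R) (xp : R -> V -> V)
    (x0 : V) (g0 : V -> R)
    (x : nat -> V) (g : nat -> V -> R) (lam : nat -> R) : Prop :=
  exists (Lam : nat -> R) (j : nat -> nat),
    [/\ x 0%N = x0, g 0%N = g0, Lam 0%N = Lam0 &
     forall k,
      [/\ lam k = 2 ^+ j k * Lam k,
          accepted alpha beta xp (lam k) (x k) /\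
          (forall i, (i < j k)%N ->
             ~ accepted alpha beta xp (2 ^+ i * Lam k) (x k)),
          x k.+1 = xp (lam k) (x k),
          g k.+1 = psi_deriv (lam k) (x k) (x k.+1)
        & Lam k.+1 = lam k / 2]].

End Problem.

(* This forces a --> 0 when a is nonnegative. *)
Definition superlinear {R : realType} (a : nat -> R) : Prop :=
  exists eps : nat -> R, eps @ \oo --> (0 : R) /\
    \forall k \near \oo, a k.+1 <= eps k * a k.

(* Main.v *)
From HB Require Import structures.
Require Import Defs.
From mathcomp Require Import all_boot all_order all_algebra.
From mathcomp Require Import all_classical all_reals all_analysis.
From mathcomp Require Import ring lra.
Set Implicit Arguments.
Unset Strict Implicit.
Unset Printing Implicit Defensive.
Import Order.TTheory GRing.Theory Num.Theory.
Import numFieldNormedType.Exports.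
Local Open Scope classical_set_scope.
Local Open Scope ring_scope.

(** Write d = y - x for a step from x to y with parameter lambda, and F' for
    the subgradient of F that the step produces.

    The optimality condition of the step is an inclusion in the subdifferential
    of psi. Monotonicity of that subdifferential, tested against a subgradient
    at x and against - f'(xs) at xs, gives
      (mu + lambda) |d| <= |F'(x)|                           [newton_step_le]
      (mu + lambda) |y - xs|
        <= |f'(x) - f'(xs) - H(x)(x - xs)| + lambda |x - xs|  [newton_step_error].
    By semismoothness the first term on the right of the second inequality is
    o(|x - xs|), so everything rests on the convergence of lambda_k to 0: then
    the distances are superlinear by newton_step_error; the norms of F' by
    newton_step_le and the first acceptance test, which says that
    |F'(y)| <= (lambda / alpha) |d|; and the gaps F - F(xs) because that test,
    convexity of F near xs and gradient domination give
    (1 + 2 alpha mu / lambda) (F(y) - F(xs)) <= F(x) - F(xs) (gap_contraction).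

    Why lambda_k tends to 0: F'(y) is the linearization residual
    f'(y) - f'(x) - H(x) d minus lambda times the Riesz image of d. If the
    residual is at most lambda |d| / 5, then F'(y) is close to - lambda d and
    both acceptance tests hold, the second one by convexity of F near xs
    (newton_step_tests). The value lambda_k / 2 was either rejected at step k
    or is lambda_(k-1) / 4; so whenever the half step from x_k has a residual
    small against lambda_k, one has lambda_k = lambda_(k-1) / 2. Since the
    residual is at most L |d|, the sequence lambda_k is bounded; hence the gaps
    decrease geometrically and x_k converges to xs. Once the residual of the
    half step is o(|d|), lambda_k is halved as long as it exceeds any given
    threshold, hence tends to 0 (halving_cvg0). The variation condition on the
    operators yields this residual condition through semismoothness at both
    ends of the half step (residual_of_operators).

    For the half steps to make sense for small lambda, the subproblems must be
    solvable there: strong convexity of the model gives a minimizer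
    (quad_min_exists, newton_step_exists). The iterates stay near xs because a
    step expands the distance by 1 + L / mu at most, after which the decrease of
    F and quadratic growth bring it back below basin_radius (run_basin). *)

(** * Continuous linear forms and their norm *)

Section DualNorm.
Context {R : realType} {V : completeNormedModType R}.
Implicit Types (g h : V -> R) (C : R).

Lemma dual_lin g (hg : dual g) a x y : g (a *: x + y) = a * g x + g y.
Proof. by case: hg => + _; apply. Qed.

Lemma dual0 g (hg : dual g) : g 0 = 0.
Proof.
by have := dual_lin hg (-1) 0 0; rewrite scaleN1r addr0 oppr0 mulN1r addNr.
Qed.

Lemma dualZ g (hg : dual g) a x : g (a *: x) = a * g x.
Proof. by have := dual_lin hg a x 0; rewrite !addr0 dual0 ?addr0. Qed.

Lemma dualD g (hg : dual g) x y : g (x + y) = g x + g y.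
Proof. by have := dual_lin hg 1 x y; rewrite scale1r mul1r. Qed.

Lemma dualN g (hg : dual g) x : g (- x) = - g x.
Proof. by rewrite -scaleN1r dualZ// mulN1r. Qed.

Lemma dual_bounded g : dual g ->
  exists2 C, 0 < C & forall d, `|g d| <= C * `|d|.
Proof.
case=> gl gc.
pose gL := HB.pack_for {linear V -> R^o} g (GRing.isLinear.Build _ _ _ _ g gl).
exact: (@linear_lipschitz R V R^o gL gc).
Qed.

Lemma bounded_dual g C : scalar g -> (forall d, `|g d| <= C * `|d|) -> dual g.
Proof.
move=> gl gC; split => //.
pose gL := HB.pack_for {linear V -> R^o} g (GRing.isLinear.Build _ _ _ _ g gl).
apply: (@bounded_linear_continuous R V R^o gL).
apply/ex_bound; exists (`|C|).
have : \forall x \near (0 : V), `|x| <= 1.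
  near=> x; near: x; apply/nbhs_ballP; exists 1 => //= x.
  by rewrite -ball_normE /= sub0r normrN => /ltW.
apply: filterS => x x1; apply: le_trans (gC x) _.
rewrite (le_trans (ler_wpM2r (normr_ge0 _) (ler_norm C)))//.
by rewrite ler_piMr.
Unshelve. all: by end_near. Qed.

Lemma dualDf g h : dual g -> dual h -> dual (g + h).
Proof.
move=> hg hh; split; last by move=> x; apply: cvgD; [apply: hg.2|apply: hh.2].
by move=> a x y /=; rewrite !fctE !dual_lin//; ring.
Qed.

Lemma dualZf a g : dual g -> dual (a *: g).
Proof.
move=> hg; split; last by move=> x; apply: cvgZr; apply: hg.2.
by move=> b x y /=; rewrite !fctE /GRing.scale/= !dual_lin//; ring.
Qed.

Lemma dualNf g : dual g -> dual (- g).
Proof. by move=> hg; rewrite -scaleN1r; exact: dualZf. Qed.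

Lemma dualBf g h : dual g -> dual h -> dual (g - h).
Proof. by move=> hg hh; apply: dualDf => //; apply: dualNf. Qed.

Let unit_values g := [set `|g d| | d in [set d : V | `|d| <= 1]].

Let unit_values0 g : dual g -> unit_values g 0.
Proof. by move=> hg; exists 0; rewrite ?dual0//= ?normr0. Qed.

Let unit_values_ub g : dual g -> has_ubound (unit_values g).
Proof.
move=> /dual_bounded[C C0 gC]; exists C => _ [d /= d1 <-].
by rewrite (le_trans (gC d))// ler_piMr// ltW.
Qed.

Lemma dual_norm_ge0 g : dual g -> 0 <= dual_norm g.
Proof. by move=> hg; apply: ub_le_sup; [exact: unit_values_ub|exact: unit_values0]. Qed.

Lemma dual_norm_ge g d : dual g -> `|g d| <= dual_norm g * `|d|.
Proof.
move=> hg; have [->|d0] := eqVneq d 0; first by rewrite dual0// !normr0 mulr0.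
have nd : 0 < `|d| by rewrite normr_gt0.
rewrite -ler_pdivrMr//; apply: ub_le_sup; first exact: unit_values_ub.
exists (`|d|^-1 *: d) => /=.
  by rewrite normrZ normfV normr_id mulVf// gt_eqF.
by rewrite dualZ// normrM normfV normr_id mulrC.
Qed.

Lemma dual_norm_le g C : dual g -> 0 <= C -> (forall d, `|g d| <= C * `|d|) ->
  dual_norm g <= C.
Proof.
move=> hg C0 gC; apply: ge_sup; first by exists 0; exact: unit_values0.
by move=> _ [d /= d1 <-]; rewrite (le_trans (gC d))// ler_piMr.
Qed.

Lemma dual_normD g h : dual g -> dual h ->
  dual_norm (g + h) <= dual_norm g + dual_norm h.
Proof.
move=> hg hh; apply: dual_norm_le; first exact: dualDf.
  by rewrite addr_ge0 ?dual_norm_ge0.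
move=> d; rewrite fctE (le_trans (ler_normD _ _))// mulrDl.
by rewrite lerD// dual_norm_ge.
Qed.

Lemma dual_normN g : dual_norm (- g) = dual_norm g.
Proof.
rewrite /dual_norm; congr sup; apply/seteqP.
by split=> _ [d d1 <-]; exists d => //; rewrite !fctE normrN.
Qed.

Lemma dual_normB g h : dual g -> dual h ->
  dual_norm (g - h) <= dual_norm g + dual_norm h.
Proof.
by move=> hg hh; rewrite -(dual_normN h); apply: dual_normD => //; exact: dualNf.
Qed.

End DualNorm.

(** * The Riesz map *)

Section Operators.
Context {R : realType} {V : completeNormedModType R}.
Variables (dot : {dot V for @idfun R}) (hdot : hilbert_dot dot).

Lemma dotC x y : dot x y = dot y x.
Proof. by have := hermC dot x y; rewrite expr0 mul1r. Qed.

Lemma riesz_lin x : scalar (riesz dot x).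
Proof. by move=> a y z; rewrite /riesz linearPr. Qed.

(** Cauchy-Schwarz: expand the square of the norm of |y| x - |x| y and divide
    by 2 |x| |y|. *)
Lemma dot_le x y : dot x y <= `|x| * `|y|.
Proof.
have [->|x0] := eqVneq x 0; first by rewrite linear0l normr0 mul0r.
have [->|y0] := eqVneq y 0; first by rewrite linear0r normr0 mulr0.
have := sqr_ge0 `| `|y| *: x - `|x| *: y|.
rewrite hdot linearBl linearBr !linearBr/= !linearZl_LR !linearZr_LR/=.
rewrite -!hdot (dotC y x).
have : 0 < `|x| * `|y| by rewrite mulr_gt0 ?normr_gt0.
set a := `|x|; set b := `|y|; set c := dot x y => ab h.
have {h} : 0 <= (a * b) * (a * b - c).
  by rewrite /GRing.scale/= in h; lra.
by rewrite pmulr_rge0// subr_ge0.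
Qed.

Lemma dot_norm_le x y : `|dot x y| <= `|x| * `|y|.
Proof.
by rewrite ler_norml dot_le andbT lerNl -linearNl -(normrN x) dot_le.
Qed.

Lemma riesz_dual x : dual (riesz dot x).
Proof. by apply: (@bounded_dual _ _ _ `|x|) => [|d]; [exact: riesz_lin|exact: dot_norm_le]. Qed.

Lemma riesz_op : sym_bounded_op (riesz dot).
Proof.
split; first exact: riesz_dual.
- by move=> a d e; apply/funext => y; rewrite /riesz !fctE linearPl.
- exists 1 => d; rewrite mul1r; apply: dual_norm_le => //; first exact: riesz_dual.
  exact: dot_norm_le.
- by move=> d e; exact: dotC.
Qed.

End Operators.

(** * Subgradients along rays *)

Section Subgradients.
Context {R : realType} {V : completeNormedModType R}.
Implicit Types (f h : V -> R) (psi : V -> \bar R) (g p : V -> R).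

(** A one-sided directional derivative that is linear in the direction. It
    covers both a Frechet derivative and the explicit expansion of a quadratic,
    and it is what Fermat's rule uses. *)
Definition ray_derivative h (y : V) p := forall v (eps : R), 0 < eps ->
  \forall t \near 0^'+, `|h (y + t *: v) - h y - t * p v| <= eps * t.

Lemma differentiable_ray f (y : V) :
  differentiable f y -> ray_derivative f y (grad f y).
Proof.
move=> df v eps eps0.
have dv := deriveE v df.
have /cvgrPdist_le/(_ _ eps0) lim_quot : h^-1 *: ((f \o shift y) (h *: v) - f y)
    @[h --> 0^'] --> 'D_v f y by exact: diff_derivable.
have : \forall t \near 0^'+,
  `|'D_v f y - t^-1 *: ((f \o shift y) (t *: v) - f y)| <= eps.
  move: lim_quot; rewrite !near_withinE; apply: filterS => t tP t0.
  by apply: tP; rewrite gt_eqF.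
move=> near_quot; near=> t.
have t0 : 0 < t by near: t; exact: nbhs_right_gt.
have : `|'D_v f y - t^-1 *: ((f \o shift y) (t *: v) - f y)| <= eps by near: t.
rewrite dv /grad /= (addrC _ y) => quot.
rewrite /GRing.scale/= in quot.
have -> : f (y + t *: v) - f y - t * 'd f y v =
    - (t * ('d f y v - t^-1 * (f (y + t *: v) - f y))).
  by field; rewrite gt_eqF.
by rewrite normrN normrM gtr0_norm// mulrC ler_pM2r.
Unshelve. all: by end_near. Qed.

Lemma near_ray (y v : V) (P : set V) :
  nbhs y P -> \forall t \near 0^'+, P (y + t *: v).
Proof.
move=> yP; have : (fun t : R => y + t *: v) @ 0 --> y + 0 *: v.
  by apply: cvgD; [exact: cvg_cst|apply: cvgZl; exact: cvg_id].
by rewrite scale0r addr0 => /cvg_at_right_filter; exact.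
Qed.

Lemma subdiff_fin psi x g : proper_fun psi -> subdiff psi x g ->
  psi x \is a fin_num.
Proof.
move=> [psiNy [z zfin]] [_ /(_ z)]; move: zfin; rewrite /edom/=.
have := psiNy x; have := psiNy z.
by case: (psi x) => [a| |]; case: (psi z).
Qed.

Lemma subdiff_monotone psi x y g h : proper_fun psi ->
  subdiff psi x g -> subdiff psi y h -> g (y - x) <= h (y - x).
Proof.
move=> ppsi gx hy.
have := gx.2 y; have := hy.2 x.
rewrite -(fineK (subdiff_fin ppsi gx)) -(fineK (subdiff_fin ppsi hy)).
rewrite -!EFinD !lee_fin -[x - y]opprB (dualN hy.1); lra.
Qed.

Lemma convex_on_segment (A : set V) (phi : V -> \bar R) x y (a b t : R) :
  convex_on A phi -> A x -> A y -> 0 <= t <= 1 ->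
  phi x = a%:E -> phi y = b%:E ->
  (phi (y + t *: (x - y))%R <= (t * a + (1 - t) * b)%:E)%E.
Proof.
move=> cA Ax Ay t01 pa pb; have := cA x y t Ax Ay t01.
rewrite pa pb -!EFinM -EFinD; congr (phi _ <= _)%E.
by rewrite scalerBl scalerBr scale1r addrCA.
Qed.

(** Fermat's rule. Along the segment from y to z, minimality of the sum at y
    and the chord inequality for psi give
    0 <= t (p (z - y) + eps + psi z - psi y) for small t > 0, so that a local
    minimum yields the global subgradient inequality. *)
Lemma fermat_composite psi h y p : proper_fun psi -> convex_on setT psi ->
  dual p -> ray_derivative h y p -> (psi y < +oo)%E ->
  (\forall z \near y, (h y)%:E + psi y <= (h z)%:E + psi z)%E ->
  subdiff psi y (- p).
Proof.
move=> ppsi cpsi hp hder yfin ymin; split; first exact: dualNf.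
move=> z; have psiNy := ppsi.1.
have [a ya] : exists a, psi y = a%:E.
  by move: yfin (psiNy y); case: (psi y) => // a; exists a.
have := psiNy z; case zb: (psi z) => [b| |] // _; last by rewrite leey.
rewrite ya -EFinD lee_fin fctE.
apply/ler_addgt0Pr => eps eps0.
near (0:R)^'+ => t.
have t0 : 0 < t by near: t; exact: nbhs_right_gt.
have t1 : t <= 1 by near: t; exact: nbhs_right_le.
have : `|h (y + t *: (z - y)) - h y - t * p (z - y)| <= eps * t.
  by near: t; exact: hder.
have : ((h y)%:E + psi y <=
        (h (y + t *: (z - y))%R)%:E + psi (y + t *: (z - y))%R)%E.
  by near: t; exact: near_ray ymin.
have := @convex_on_segment setT psi z y b a t cpsi I I _ zb ya.
rewrite (ltW t0) t1 => /(_ isT); rewrite ya.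
case: (psi (y + t *: (z - y))) (psiNy (y + t *: (z - y))) => // c _.
rewrite -!EFinD !lee_fin ler_norml => cle hle /andP[_ dle].
have : 0 <= t * (p (z - y) + eps + b - a) by nra.
rewrite pmulr_rge0//; lra.
Unshelve. all: by end_near. Qed.

(** Convexity belongs to the sum: the increment of f + psi over a short step
    towards x is at most its share of the total increment, and at least the
    linear forms at y up to o(t). *)
Lemma convex_sum_subgradient f psi (A : set V) x y g : proper_fun psi ->
  convex_on A (objective f psi) -> A x -> A y -> differentiable f y ->
  subdiff psi y g ->
  (objective f psi y + (grad f y (x - y) + g (x - y))%R%:E <= objective f psi x)%E.
Proof.
move=> ppsi cF Ax Ay df gy; have psiNy := ppsi.1.
rewrite /objective; have yfin := subdiff_fin ppsi gy.
have := psiNy x; case xb: (psi x) => [b| |] // _; last by rewrite addey// leey.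
have := fineK yfin; set a := fine (psi y) => /esym ya.
rewrite ya -!EFinD lee_fin.
apply/ler_addgt0Pr => eps eps0.
near (0:R)^'+ => t.
have t0 : 0 < t by near: t; exact: nbhs_right_gt.
have t1 : t <= 1 by near: t; exact: nbhs_right_le.
have : `|f (y + t *: (x - y)) - f y - t * grad f y (x - y)| <= eps * t.
  by near: t; exact: differentiable_ray.
have := @convex_on_segment A _ x y (f x + b) (f y + a) t cF Ax Ay.
rewrite (ltW t0) t1 /objective xb ya => /(_ isT erefl erefl).
have := gy.2 (y + t *: (x - y)).
rewrite (_ : y + t *: (x - y) - y = t *: (x - y)); last first.
  by rewrite addrAC subrr add0r.
rewrite (dualZ gy.1) ya -EFinD.
case: (psi (y + t *: (x - y))) (psiNy (y + t *: (x - y))) => // c _.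
rewrite -!EFinD !lee_fin ler_norml => gle cle /andP[dle _].
have : 0 <= t * (f x + b + eps - (f y + a + (grad f y (x - y) + g (x - y)))) by nra.
rewrite pmulr_rge0//; lra.
Unshelve. all: by end_near. Qed.

End Subgradients.

(** * Minimizing a strongly convex quadratic plus a convex function *)

Section StronglyConvexMinimum.
Context {R : realType} {V : completeNormedModType R}.
Implicit Types (psi : V -> \bar R) (l g : V -> R) (A : V -> V -> R).

Lemma sym_bounded_opD A B : sym_bounded_op A -> sym_bounded_op B ->
  sym_bounded_op (fun d => A d + B d).
Proof.
move=> [dA lA [CA bA] sA] [dB lB [CB bB] sB]; split.
- by move=> d; exact: dualDf.
- move=> a d e; rewrite lA lB; apply/funext => z; rewrite !fctE/=.
  by rewrite /GRing.scale/=; ring.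
- exists (CA + CB) => d; rewrite (le_trans (dual_normD (dA d) (dB d)))//.
  by rewrite mulrDl lerD.
- by move=> d e; rewrite !fctE sA sB.
Qed.

Lemma sym_bounded_opZ a A : sym_bounded_op A ->
  sym_bounded_op (fun d => a *: A d).
Proof.
move=> [dA lA [CA bA] sA]; split.
- by move=> d; exact: dualZf.
- move=> b d e; rewrite lA; apply/funext => z; rewrite !fctE/=.
  by rewrite /GRing.scale/=; ring.
- exists (`|a| * CA) => d; apply: dual_norm_le; first exact: dualZf.
    by rewrite -mulrA mulr_ge0// (le_trans (dual_norm_ge0 (dA d)) (bA d)).
  move=> e; rewrite fctE normrM -!mulrA ler_wpM2l// mulrA.
  by rewrite (le_trans (dual_norm_ge _ (dA d)))// ler_wpM2r.
- by move=> d e; rewrite !fctE sA.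
Qed.

Lemma opDl A d e z : sym_bounded_op A -> A (d + e) z = A d z + A e z.
Proof. by move=> [_ lA _ _]; rewrite -{1}(scale1r d) lA scale1r. Qed.

Lemma opZl A a d z : sym_bounded_op A -> A (a *: d) z = a * A d z.
Proof.
move=> [dA lA _ sA]; rewrite -{1}(addr0 (a *: d)) lA fctE (sA 0 z).
by rewrite (dual0 (dA z)) addr0.
Qed.

Lemma opNl A d z : sym_bounded_op A -> A (- d) z = - A d z.
Proof. by move=> hA; rewrite -scaleN1r opZl// mulN1r. Qed.

Definition quad l A (x y : V) : R := l (y - x) + 2^-1 * A (y - x) (y - x).

Lemma quad_taylor l A x y v : dual l -> sym_bounded_op A ->
  quad l A x (y + v) =
  quad l A x y + (l v + A (y - x) v) + 2^-1 * A v v.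
Proof.
move=> hl hA; have [dA _ _ sA] := hA; rewrite /quad addrAC.
move: (y - x) => d.
rewrite (dualD hl) (dualD (dA _)) !opDl// (sA v d); by field.
Qed.

Lemma quad_ray_derivative l A x y : dual l -> sym_bounded_op A ->
  ray_derivative (quad l A x) y (l + A (y - x)).
Proof.
move=> hl hA v eps eps0; have [dA _ _ sA] := hA.
have c0 : 0 < 2 * eps / (`|A v v| + 1).
  by rewrite divr_gt0 ?mulr_gt0// ltr_wpDl.
near=> t.
have t0 : 0 < t by near: t; exact: nbhs_right_gt.
have tc : t <= 2 * eps / (`|A v v| + 1) by near: t; exact: nbhs_right_le.
rewrite quad_taylor// (dualZ hl) (dualZ (dA _)) (dualZ (dA _)) opZl// !fctE.
rewrite (_ : _ - t * (l v + A (y - x) v) = t * (2^-1 * (t * A v v)));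
  last by field.
rewrite normrM gtr0_norm// mulrC ler_pM2r// normrM gtr0_norm// normrM gtr0_norm//.
move: tc; rewrite ler_pdivlMr; last by rewrite ltr_wpDl.
lra.
Unshelve. all: by end_near. Qed.

(** The direct method. The subgradient at x is an affine minorant of psi, which
    with coercivity bounds the sum from below; comparing values at two points
    and at their midpoint shows that a minimizing sequence is Cauchy; lower
    semicontinuity of psi passes to the limit. *)
Lemma quad_min_exists psi l A (mu : R) x g : proper_fun psi ->
  convex_on setT psi -> lower_semicontinuous psi ->
  dual l -> sym_bounded_op A -> 0 < mu -> (forall d, mu * `|d| ^+ 2 <= A d d) ->
  subdiff psi x g ->
  exists y, (psi y < +oo)%E /\ forall z,
    ((quad l A x y)%:E + psi y <= (quad l A x z)%:E + psi z)%E.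
Proof.
move=> ppsi cpsi lpsi hl hA mu0 coerA gx.
have [dA _ _ sA] := hA; have psiNy := ppsi.1.
pose D := [set z | (psi z < +oo)%E].
have finD z : D z -> psi z = (fine (psi z))%:E.
  by move=> Dz; rewrite fineK// fin_numE gt_eqF// lt_eqF.
pose Phi z := quad l A x z + fine (psi z).
have Dx : D x by rewrite /D/= ltey_eq (subdiff_fin ppsi gx).
have PhiD z : D z -> ((quad l A x z)%:E + psi z)%E = (Phi z)%:E.
  by move=> Dz; rewrite finD// -EFinD.
have infE : has_inf (Phi @` D).
  split; first by exists (Phi x); exists x.
  have hlg := dualDf hl gx.1; pose c := dual_norm (l + g).
  exists (fine (psi x) - c ^+ 2 / (2 * mu)) => _ [z Dz <-].
  have := gx.2 z; rewrite (finD _ Dx) (finD _ Dz) -EFinD lee_fin => gz.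
  have := dual_norm_ge (z - x) hlg; rewrite ler_norml fctE => /andP[+ _].
  have := coerA (z - x); rewrite -/c /Phi /quad.
  set n := `|z - x|; set q := A _ _ => qn ln.
  have sq : 0 <= (c - mu * n) ^+ 2 / (2 * mu).
    by rewrite divr_ge0 ?sqr_ge0// mulr_ge0// ltW.
  have -> : c ^+ 2 / (2 * mu) =
    (c - mu * n) ^+ 2 / (2 * mu) + c * n - 2^-1 * (mu * n ^+ 2).
    by field; rewrite gt_eqF.
  lra.
set I := inf (Phi @` D).
have Ile z : D z -> I <= Phi z by move=> Dz; apply: ge_inf; [exact: infE.2|exists z].
(* The convexity gap at the midpoint z + (y - z) / 2. *)
have gap y z : D y -> D z ->
  mu / 8 * `|y - z| ^+ 2 <= (Phi y + Phi z) / 2 - I.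
  move=> Dy Dz; have [v vE] : exists v, v = 2^-1 *: (y - z) by eexists.
  have := @convex_on_segment _ _ setT psi y z _ _ 2^-1 cpsi Logic.I Logic.I _
    (finD _ Dy) (finD _ Dz).
  rewrite invr_ge0 ler0n invf_le1 ?ler1n// => /(_ isT); rewrite -vE => vle.
  have Dv : D (z + v) by rewrite /D/= (le_lt_trans vle) ?ltry.
  have := Ile _ Dv; move: vle; rewrite (finD _ Dv) lee_fin /Phi => vle Iv.
  have yE : y = z + 2 *: v by rewrite vE scalerA divff// scale1r addrC subrK.
  have := coerA (y - z).
  have -> : y - z = 2 *: v by rewrite {1}yE addrC addKr.
  rewrite (opZl _ _ _ hA) (dualZ (dA _)).
  move: Iv; rewrite quad_taylor// [in quad _ _ _ y]yE quad_taylor//.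
  rewrite (opZl _ _ _ hA) !(dualZ (dA _)) (dualZ hl); lra.
have approx n : exists y, D y /\ Phi y < I + n.+1%:R^-1.
  have n0 : 0 < n.+1%:R^-1 :> R by rewrite invr_gt0.
  have [_ [y Dy <-] ylt] := inf_adherent n0 infE.
  by exists y.
have [y_ y_P] := choice approx.
have cvy : cvg (y_ @ \oo).
  apply/cauchy_cvgP; apply: cauchy_exP => e e0.
  have e1 : 0 < mu / 8 * e ^+ 2 by rewrite mulr_gt0 ?divr_gt0 ?exprn_gt0.
  near \oo => N; exists (y_ N).
  have Ne : N.+1%:R^-1 < mu / 8 * e ^+ 2.
    by near: N; exact: (near_infty_natSinv_lt (PosNum e1)).
  exists N => // n /= Nn; rewrite -ball_normE /=.
  have := gap _ _ (y_P N).1 (y_P n).1.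
  have := (y_P N).2; have := (y_P n).2.
  have : n.+1%:R^-1 <= N.+1%:R^-1 :> R by rewrite lef_pV2 ?posrE// ler_nat ltnS.
  move=> nN Pn PN gapN; rewrite -(ltr_pXn2r (n := 2))// ?nnegrE// ?ltW//.
  rewrite -(ltr_pM2l (x := mu / 8)) ?divr_gt0//.
  move: Ne nN Pn PN gapN; move: (N.+1%:R^-1) (n.+1%:R^-1) => a b; lra.
set y := lim (y_ @ \oo) in cvy *.
have Iy : (psi y <= (I - quad l A x y)%:E)%E.
  rewrite leNgt; apply/negP => /= lt_psi.
  have [c Ic cpsiy] : exists2 c, I - quad l A x y < c & (c%:E < psi y)%E.
    case: (psi y) (psiNy y) lt_psi => [a||]// _.
      rewrite lte_fin => Ia; exists ((I - quad l A x y + a) / 2); first lra.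
      by rewrite lte_fin; lra.
    by move=> _; exists (I - quad l A x y + 1); [lra|exact: ltry].
  have [U yU Uc] := lpsi _ _ cpsiy.
  (* By Taylor expansion at the limit y, the quadratic at y_ n is at least its
     value at y minus C times the distance. *)
  have hp := dualDf hl (dA (y - x)).
  pose C := dual_norm (l + A (y - x)) + 1.
  have C0 : 0 < C by rewrite ltr_wpDl// dual_norm_ge0.
  pose e := (c - (I - quad l A x y)) / 2.
  have e0 : 0 < e by rewrite /e; lra.
  near \oo => n.
  have yn : `|y - y_ n| < e / C.
    by near: n; apply: cvgr_dist_lt => //; rewrite divr_gt0.
  have ne : n.+1%:R^-1 < e by near: n; exact: (near_infty_natSinv_lt (PosNum e0)).
  have /Uc : U (y_ n) by near: n; exact: cvy.
  have [Dn Pn] := y_P n; move: (n.+1%:R^-1) ne Pn => b ne Pn.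
  rewrite (finD _ Dn) lte_fin; move: Pn; rewrite /Phi.
  have qE : quad l A x (y + (y_ n - y)) = quad l A x (y_ n) by rewrite addrC subrK.
  rewrite -qE quad_taylor//.
  have := dual_norm_ge (y_ n - y) hp; rewrite ler_norml fctE => /andP[+ _].
  have := coerA (y_ n - y).
  have : 0 <= mu * `|y_ n - y| ^+ 2 by rewrite mulr_ge0 ?sqr_ge0 ?ltW.
  move: yn; rewrite distrC ltr_pdivlMr// /C.
  have := normr_ge0 (y_ n - y); rewrite /e in ne *; nra.
have Dy : D y by rewrite /D/= (le_lt_trans Iy) ?ltry.
exists y; split => // z.
have := psiNy z; case zb: (psi z) => [b| |] // _; last by rewrite addey// leey.
have Dz : D z by rewrite /D/= zb ltry.
rewrite -zb !PhiD// lee_fin (le_trans _ (Ile _ Dz))//.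
by move: Iy; rewrite (finD _ Dy) lee_fin /Phi; lra.
Unshelve. all: by end_near. Qed.

End StronglyConvexMinimum.

(** * One regularized Newton step *)

Section NewtonStep.
Context {R : realType} {V : completeNormedModType R}.
Variables (dot : {dot V for @idfun R}) (hdot : hilbert_dot dot).
Variables (f : V -> R) (psi : V -> \bar R) (H : V -> V -> V -> R).
Hypothesis df : forall x, differentiable f x.
Hypothesis ppsi : proper_fun psi.
Hypothesis hH : forall x, sym_bounded_op (H x).
Implicit Types (x y xs : V) (g : V -> R) (lambda tau : R).
Local Notation F := (objective f psi).

Lemma grad_dual x : dual (grad f x).
Proof.
split; last by have := diff_continuous (df x); apply.
by move=> a u v; rewrite /grad linearP.
Qed.

Lemma op_dual x d : dual (H x d). Proof. by case: (hH x). Qed.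

(** The Hessian of the regularized model. *)
Let reg lambda x d := H x d + lambda *: riesz dot d.

Let reg_op lambda x : sym_bounded_op (reg lambda x).
Proof. exact: sym_bounded_opD (hH x) (sym_bounded_opZ _ (riesz_op hdot)). Qed.

Let regE lambda x d : reg lambda x d d = H x d d + lambda * `|d| ^+ 2.
Proof. by rewrite hdot. Qed.

Lemma psi_derivE lambda x y :
  psi_deriv dot f H lambda x y = - (grad f x + reg lambda x (y - x)).
Proof. by rewrite /psi_deriv /reg !opprD !addrA. Qed.

Lemma modelE lambda x y :
  model f psi H lambda x y =
  ((f x)%:E + ((quad (grad f x) (reg lambda x) x y)%:E + psi y))%E.
Proof.
rewrite /model addeA -EFinD; congr (_%:E + _)%E.
by rewrite /quad regE; field.
Qed.

(** For lambda below the constant of the subproblem assumption, solvability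
    comes from the coercivity of H x. *)
Lemma newton_step_exists lambda (mu : R) x g : convex_on setT psi ->
  lower_semicontinuous psi -> 0 < mu -> 0 <= lambda ->
  (forall d, mu * `|d| ^+ 2 <= H x d d) -> subdiff psi x g ->
  exists y, admissible dot f psi H lambda x y.
Proof.
move=> cpsi lpsi mu0 l0 Hmu gx.
have coer d : mu * `|d| ^+ 2 <= reg lambda x d d.
  by rewrite regE (le_trans (Hmu d))// lerDl mulr_ge0 ?sqr_ge0.
have [y [yfin ymin]] := quad_min_exists ppsi cpsi lpsi (grad_dual x)
  (reg_op lambda x) mu0 coer gx.
exists y; split; last by rewrite !modelE leeD2l.
rewrite psi_derivE; apply: fermat_composite ppsi cpsi _ _ yfin _.
- by apply: dualDf; [exact: grad_dual|have [] := reg_op lambda x].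
- exact: quad_ray_derivative (grad_dual x) (reg_op lambda x).
- by near=> z; exact: ymin.
Unshelve. all: by end_near. Qed.

Lemma mul_sqr_le (a b c : R) : 0 <= b -> 0 <= c -> a * b ^+ 2 <= c * b -> a * b <= c.
Proof.
rewrite le_eqVlt => /predU1P[<-|b0] c0; first by move=> _; rewrite mulr0.
by rewrite expr2 mulrA ler_pM2r.
Qed.

(** Monotonicity of the subdifferential of psi, between x and y. *)
Lemma newton_step_le lambda (mu : R) x y g :
  (forall d, mu * `|d| ^+ 2 <= H x d d) ->
  subdiff psi x g -> subdiff psi y (psi_deriv dot f H lambda x y) ->
  (mu + lambda) * `|y - x| <= dual_norm (grad f x + g).
Proof.
move=> Hmu gx gy; have hg := dualDf (grad_dual x) gx.1.
apply: mul_sqr_le => //; first exact: dual_norm_ge0.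
have := subdiff_monotone ppsi gx gy.
rewrite psi_derivE !fctE -/(reg _ _ _) regE.
have := dual_norm_ge (y - x) hg; rewrite ler_norml fctE => /andP[+ _].
by have := Hmu (y - x); lra.
Qed.

(** Monotonicity between xs and y, with the step y - x split at xs as
    (y - xs) - (x - xs): coercivity applies to the first part, and the second
    one joins f'(x) - f'(xs) in the linearization error. *)
Lemma newton_step_error lambda (mu : R) x y xs : 0 <= lambda ->
  (forall d, mu * `|d| ^+ 2 <= H x d d) ->
  subdiff psi xs (- grad f xs) -> subdiff psi y (psi_deriv dot f H lambda x y) ->
  (mu + lambda) * `|y - xs| <=
  dual_norm (grad f x - grad f xs - H x (x - xs)) + lambda * `|x - xs|.
Proof.
move=> l0 Hmu gxs gy.
have hw : dual (grad f x - grad f xs - H x (x - xs)).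
  by apply: dualBf; [apply: dualBf; exact: grad_dual|exact: op_dual].
apply: mul_sqr_le => //; first by rewrite addr_ge0 ?mulr_ge0// dual_norm_ge0.
have := subdiff_monotone ppsi gxs gy.
have -> : psi_deriv dot f H lambda x y =
    - (grad f x + (reg lambda x (y - xs) - reg lambda x (x - xs))).
  rewrite psi_derivE; congr (- (_ + _)); apply/funext => z.
  have e : y - x = (y - xs) + - (x - xs) by rewrite opprB addrA subrK.
  by rewrite e (opDl _ _ _ (reg_op lambda x)) (opNl _ _ (reg_op lambda x)).
have := dual_norm_ge (y - xs) hw; rewrite ler_norml => /andP[+ _].
rewrite !fctE regE /reg !fctE /GRing.scale/= /riesz.
have := Hmu (y - xs); have := dot_le hdot (x - xs) (y - xs).
move: (dual_norm _) (dot _ _) (H x (x - xs) _) => N D h Dle.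
have : lambda * D <= lambda * (`|x - xs| * `|y - xs|) by rewrite ler_wpM2l.
lra.
Qed.

(** F' splits into the linearization error of f' and the regularization, the
    form in which it is nearly a multiple of x - y. *)
Lemma F_derivE lambda x y :
  F_deriv dot f H lambda x y =
  (grad f y - grad f x - H x (y - x)) - lambda *: riesz dot (y - x).
Proof. by rewrite /F_deriv /psi_deriv !addrA. Qed.

Lemma newton_residual_dual x y : dual (grad f y - grad f x - H x (y - x)).
Proof. by apply: dualBf; [apply: dualBf; exact: grad_dual|exact: op_dual]. Qed.

Lemma F_deriv_dual lambda x y : dual (F_deriv dot f H lambda x y).
Proof.
rewrite F_derivE; apply: dualBf; first exact: newton_residual_dual.
exact/dualZf/riesz_dual.
Qed.

(** F'(y) is close to lambda (x - y) when the linearization error is small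
    against lambda |y - x|, and both tests hold with room to spare for
    lambda (x - y) itself. The factor 5 works because alpha <= 1/2 and
    (1 + 1/5)^2 / 2 <= 1 - 1/5. *)
Lemma newton_step_tests lambda tau alpha beta x y : 0 < lambda ->
  0 < alpha <= 2^-1 -> beta <= 2^-1 -> psi x \is a fin_num ->
  psi y \is a fin_num ->
  dual_norm (grad f y - grad f x - H x (y - x)) <= tau * `|y - x| ->
  tau <= lambda / 5 ->
  (F y + (F_deriv dot f H lambda x y (x - y))%:E <= F x)%E ->
  alpha / lambda * dual_norm (F_deriv dot f H lambda x y) ^+ 2
    <= F_deriv dot f H lambda x y (x - y) /\
  ((beta * lambda * `|y - x| ^+ 2)%:E <= F x - F y)%E.
Proof.
move=> l0 /andP[a0 a2] b2 xfin yfin wle taule sub.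
have hw := newton_residual_dual x y; have hF := F_deriv_dual lambda x y.
set n := `|y - x|; have n0 : 0 <= n := normr_ge0 _.
have wn : dual_norm (grad f y - grad f x - H x (y - x)) <= lambda / 5 * n.
  by rewrite (le_trans wle)// ler_wpM2r.
have F'ge : 4 / 5 * (lambda * n ^+ 2) <= F_deriv dot f H lambda x y (x - y).
  rewrite -[x - y]opprB (dualN hF).
  have -> : F_deriv dot f H lambda x y (y - x) =
      (grad f y - grad f x - H x (y - x)) (y - x) - lambda * n ^+ 2.
    by rewrite F_derivE /n hdot.
  have := dual_norm_ge (y - x) hw; rewrite ler_norml -/n => /andP[_].
  have : dual_norm (grad f y - grad f x - H x (y - x)) * n <= lambda / 5 * n * n.
    by rewrite ler_wpM2r.
  lra.
have F'le : dual_norm (F_deriv dot f H lambda x y) <= 6 / 5 * (lambda * n).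
  rewrite F_derivE (le_trans (dual_normB hw (dualZf _ (riesz_dual hdot _))))//.
  have : dual_norm (lambda *: riesz dot (y - x)) <= lambda * n.
    apply: dual_norm_le; first exact/dualZf/riesz_dual.
      by rewrite mulr_ge0// ltW.
    move=> d; rewrite fctE /GRing.scale/= normrM gtr0_norm// -mulrA.
    by rewrite ler_pM2l// dot_norm_le.
  lra.
split.
  rewrite (le_trans _ F'ge)// mulrAC ler_pdivrMr//.
  have : dual_norm (F_deriv dot f H lambda x y) ^+ 2 <= (6 / 5 * (lambda * n)) ^+ 2.
    by rewrite ler_pXn2r// nnegrE ?dual_norm_ge0// !mulr_ge0// ltW.
  have := sqr_ge0 (dual_norm (F_deriv dot f H lambda x y)).
  have := sqr_ge0 (lambda * n).
  move: (dual_norm _ ^+ 2) => N ln0 N0 Nle.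
  have : alpha * N <= 2^-1 * N by rewrite ler_wpM2r.
  lra.
move: sub; rewrite /objective -(fineK xfin) -(fineK yfin) -!EFinD !lee_fin => sub.
have : beta * (lambda * n ^+ 2) <= 2^-1 * (lambda * n ^+ 2).
  by rewrite ler_wpM2r// mulr_ge0 ?sqr_ge0 ?(ltW l0).
have : 0 <= lambda * n ^+ 2 by rewrite mulr_ge0 ?sqr_ge0 ?(ltW l0).
lra.
Qed.

End NewtonStep.

(** * Sequences driven by a contraction or by halving *)

Section Sequences.
Context {R : realType}.
Implicit Types (u : nat -> R).

Lemma contraction_cvg0 u (c : R) : 0 < c -> (forall k, 0 <= u k) ->
  (forall k, (1 + c) * u k.+1 <= u k) -> u @ \oo --> (0 : R).
Proof.
move=> c0 u0 uc; have c1 : 0 < 1 + c by lra.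
have ule k : u k <= u 0%N * (1 + c)^-1 ^+ k.
  elim: k => [|k IH]; first by rewrite expr0 mulr1.
  rewrite exprSr mulrA ler_pdivlMr// mulrC.
  exact: le_trans (uc k) IH.
apply: (@squeeze_cvgr _ _ _ _ (cst 0) (fun k => u 0%N * (1 + c)^-1 ^+ k)).
- by near=> k; rewrite /cst u0 ule.
- exact: cvg_cst.
- apply: cvg_geometric; rewrite ger0_norm ?invr_ge0 ?ltW// invf_lt1//; lra.
Unshelve. all: by end_near. Qed.

(** Above the threshold M the sequence can only have come from a value twice as
    large. *)
Lemma halving_bounded u (M : R) : (forall k, 0 < u k) ->
  (forall k, M <= u k.+1 -> u k.+1 = u k / 2) ->
  forall k, u k <= Num.max (u 0%N) M.
Proof.
move=> u0 half; elim=> [|k IH]; first by rewrite le_max lexx.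
have [/half ->|/ltW uM] := leP M (u k.+1); last by rewrite le_max uM orbT.
by apply: le_trans IH; have := u0 k; lra.
Qed.

(** Halving cannot go on forever above e, so the sequence falls below e; it
    cannot return, since a later value above e would be half of one below e. *)
Lemma halving_cvg0 u : (forall k, 0 < u k) ->
  (forall e : R, 0 < e ->
     \forall k \near \oo, e <= u k.+1 -> u k.+1 = u k / 2) ->
  u @ \oo --> (0 : R).
Proof.
move=> u0 half; apply/cvgrPdist_lt => e e0.
have [N _ halfN] := half _ e0.
have [K [NK Ke]] : exists K, (N <= K)%N /\ u K < e.
  apply: contrapT => nex.
  have ge k : (N <= k)%N -> e <= u k.
    by move=> Nk; rewrite leNgt; apply/negP => ue; apply: nex; exists k.
  have : (fun n => u (N + n)%N) @ \oo --> (0 : R).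
    apply: (@contraction_cvg0 _ 1) => // n; first exact: ltW.
    rewrite addnS halfN/=; [lra|exact: leq_addr|apply: ge].
    by rewrite leqW// leq_addr.
  move=> /cvgrPdist_lt/(_ _ e0)[n _ /(_ n (leqnn n))].
  by rewrite sub0r normrN gtr0_norm// ltNge ge// leq_addr.
exists K => // k /= Kk; rewrite sub0r normrN gtr0_norm//.
elim: k Kk => [|k IH]; first by rewrite leqn0 => /eqP <-.
rewrite leq_eqVlt => /predU1P[<-//|]; rewrite ltnS => Kk.
rewrite ltNge; apply/negP => ek; have := ek.
rewrite (halfN k (leq_trans NK Kk) ek); have := IH Kk; have := u0 k; lra.
Qed.

End Sequences.

(** * Convergence of the method near the minimizer *)

Section LocalConvergence.
Context {R : realType} {V : completeNormedModType R}.
Variables (dot : {dot V for @idfun R}) (hdot : hilbert_dot dot).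
Variables (f : V -> R) (psi : V -> \bar R) (H : V -> V -> V -> R).
Hypothesis df : forall x, differentiable f x.
Hypothesis ppsi : proper_fun psi.
Hypothesis cpsi : convex_on setT psi.
Hypothesis lpsi : lower_semicontinuous psi.
Hypothesis hH : forall x, sym_bounded_op (H x).
Local Notation F := (objective f psi).
Variables (xs : V) (r e L mu : R).
Hypotheses (r0 : 0 < r) (e0 : 0 < e) (L0 : 0 <= L) (mu0 : 0 < mu).
Let gap x := fine (F x - F xs)%E.
Hypothesis opt : subdiff psi xs (- grad f xs).
Hypothesis lin_error : forall x y, `|x - xs| <= r -> `|y - xs| <= r ->
  dual_norm (grad f y - grad f x - H x (y - x)) <= L * `|y - x|.
Hypothesis coercive : forall x, `|x - xs| <= r ->
  forall d, mu * `|d| ^+ 2 <= H x d d.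
Hypothesis gradient_dominated : forall x g, `|x - xs| <= r -> subdiff psi x g ->
  gap x <= dual_norm (grad f x + g) ^+ 2 / (2 * mu).
Hypothesis quadratic_growth : forall x, `|x - xs| <= r -> psi x \is a fin_num ->
  mu / 2 * `|x - xs| ^+ 2 <= gap x.
Hypothesis convex_near : convex_on (ball xs e) F.

(** Within this distance of xs, a Newton step cannot leave the region where the
    local hypotheses hold, since it expands the distance to xs by a factor
    1 + L / mu at most. The bound e / 2 keeps it inside an open ball. *)
Definition basin_radius := Num.min r (e / 2) / (1 + L / mu).
Local Notation delta := basin_radius.

Let C0 : 1 <= 1 + L / mu. Proof. by rewrite lerDl divr_ge0// ltW. Qed.

Lemma basin_radius_gt0 : 0 < delta.
Proof. by rewrite divr_gt0// ?lt_min ?r0 ?divr_gt0// (lt_le_trans ltr01). Qed.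

Lemma basin_sub z : `|z - xs| <= (1 + L / mu) * delta ->
  `|z - xs| <= r /\ ball xs e z.
Proof.
rewrite /delta mulrC divfK ?gt_eqF// ?(lt_le_trans ltr01)//.
rewrite le_min => /andP[zr ze]; split => //.
by rewrite -ball_normE /= distrC (le_lt_trans ze)//; have := e0; lra.
Qed.

Lemma basin_subW z : `|z - xs| <= delta -> `|z - xs| <= r /\ ball xs e z.
Proof.
by move=> zd; apply: basin_sub; rewrite (le_trans zd)// ler_peMl// ltW// basin_radius_gt0.
Qed.

Lemma basin_step lambda x y : 0 <= lambda -> `|x - xs| <= delta ->
  admissible dot f psi H lambda x y ->
  `|y - xs| <= r /\ ball xs e y.
Proof.
move=> l0 xd [gy _]; have [xr _] := basin_subW xd; apply: basin_sub.
have := newton_step_error hdot df ppsi hH l0 (coercive xr) opt gy.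
have xsr : `|xs - xs| <= r by rewrite subrr normr0 ltW.
have := lin_error xr xsr.
have -> : dual_norm (grad f xs - grad f x - H x (xs - x)) =
    dual_norm (grad f x - grad f xs - H x (x - xs)).
  rewrite -dual_normN; congr dual_norm; apply/funext => z; rewrite !fctE.
  by rewrite -[xs - x]opprB opNl//; ring.
rewrite (distrC xs); set s := dual_norm _ => sle yle.
have {}yle : (mu + lambda) * `|y - xs| <= (mu + lambda) * ((1 + L / mu) * delta).
  have -> : (mu + lambda) * ((1 + L / mu) * delta) =
     (L + lambda) * delta + (mu + lambda * (L / mu)) * delta.
    by field; rewrite gt_eqF.
  have : (L + lambda) * `|x - xs| <= (L + lambda) * delta.
    by rewrite ler_wpM2l// addr_ge0.
  have : 0 <= (mu + lambda * (L / mu)) * delta.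
    rewrite mulr_ge0 ?(ltW basin_radius_gt0)// addr_ge0 ?(ltW mu0)//.
    by rewrite mulr_ge0 ?divr_ge0// ltW.
  lra.
by rewrite -(ler_pM2l (x := mu + lambda)) // ltr_wpDr.
Qed.

Lemma basin_convex lambda x y : `|x - xs| <= delta -> 0 <= lambda ->
  admissible dot f psi H lambda x y ->
  (F y + (F_deriv dot f H lambda x y (x - y))%R%:E <= F x)%E.
Proof.
move=> xd l0 adm; have [gy _] := adm.
have [_ xe] := basin_subW xd; have [_ ye] := basin_step l0 xd adm.
exact: (convex_sum_subgradient ppsi convex_near xe ye (df y) gy).
Qed.

Lemma objective_fin z : psi z \is a fin_num -> F z = (f z + fine (psi z))%:E.
Proof. by move=> zfin; rewrite /objective EFinD fineK. Qed.

Lemma subdiff_edom x g : subdiff psi x g -> edom F x.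
Proof.
move=> gx; rewrite /edom/= (objective_fin (subdiff_fin ppsi gx)).
exact: ltry.
Qed.

Lemma basin_admissible lambda x g xp : `|x - xs| <= delta -> 0 <= lambda ->
  subdiff psi x g -> solution_map dot f psi H xp ->
  admissible dot f psi H lambda x (xp lambda x).
Proof.
move=> xd l0 gx hxp; have [xr _] := basin_subW xd.
apply: hxp => //; first exact: subdiff_edom gx.
exact: (newton_step_exists hdot df ppsi hH cpsi lpsi mu0 l0 (coercive xr) gx).
Qed.

Lemma basin_accepted lambda tau alpha beta x g xp : `|x - xs| <= delta ->
  0 < lambda -> subdiff psi x g -> solution_map dot f psi H xp ->
  0 < alpha <= 2^-1 -> beta <= 2^-1 ->
  let y := xp lambda x in
  dual_norm (grad f y - grad f x - H x (y - x)) <= tau * `|y - x| ->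
  tau <= lambda / 5 ->
  accepted dot f psi H alpha beta xp lambda x.
Proof.
move=> xd l0 gx hxp ha hb y resid taul.
have adm := basin_admissible xd (ltW l0) gx hxp.
have [t1 t2] := newton_step_tests hdot df hH l0 ha hb (subdiff_fin ppsi gx)
  (subdiff_fin ppsi adm.1) resid taul (basin_convex xd (ltW l0) adm).
by split.
Qed.

Section Iterates.
Variables (alpha beta Lam0 : R) (xp : R -> V -> V) (x0 : V) (g0 : V -> R).
Hypotheses (ha : 0 < alpha <= 2^-1) (hb : 0 < beta <= 2^-1) (Lam00 : 0 < Lam0).
Hypothesis hxp : solution_map dot f psi H xp.
Hypothesis g0x0 : subdiff psi x0 g0.
Hypothesis x0r : `|x0 - xs| <= r.
Hypothesis x0_small : dual_norm (grad f x0 + g0) <= mu * delta.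
Variables (x : nat -> V) (g : nat -> V -> R) (lam : nat -> R).
Hypothesis run : leap_ssn_iterates dot f psi H alpha beta Lam0 xp x0 g0 x g lam.

Let G k := dual_norm (grad f (x k) + g k).

Lemma lam_gt0 k : 0 < lam k.
Proof.
have [Lam [j [_ _ L0' step]]] := run.
have Lam_gt0 n : 0 < Lam n.
  elim: n => [|n IH]; first by rewrite L0'.
  by have [-> _ _ _ ->] := step n; rewrite divr_gt0// mulr_gt0// exprn_gt0.
by have [-> _ _ _ _] := step k; rewrite mulr_gt0// exprn_gt0.
Qed.

Lemma run_step k : [/\ accepted dot f psi H alpha beta xp (lam k) (x k),
  x k.+1 = xp (lam k) (x k) & g k.+1 = psi_deriv dot f H (lam k) (x k) (x k.+1)].
Proof.
by have [Lam [j [_ _ _ step]]] := run; have [_ [acc _] xS gS _] := step k.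
Qed.

(** If the inner loop does not stop at once, then its last rejected value is
    half of the accepted one. *)
Lemma lam_halved k : accepted dot f psi H alpha beta xp (lam k.+1 / 2) (x k.+1) ->
  lam k.+1 = lam k / 2.
Proof.
have [Lam [j [_ _ _ step]]] := run => acc.
have [lamE [_ rej] _ _ _] := step k.+1; have [_ _ _ _ <-] := step k.
case jE : (j k.+1) lamE rej => [|i] lamE rej; first by rewrite lamE expr0 mul1r.
exfalso; apply: (rej i (ltnSn i)); move: acc; rewrite lamE exprS.
by rewrite -[2 * _ * _]mulrA mulrC mulKf.
Qed.

Lemma run_subdiff k : subdiff psi (x k) (g k).
Proof.
case: k => [|k]; first by have [Lam [j [-> -> _ _]]] := run.
by have [[[]]] := run_step k => /= gy _ _ _ xS gS; rewrite gS xS.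
Qed.

Let fin_x k : psi (x k) \is a fin_num.
Proof. exact: subdiff_fin (run_subdiff k). Qed.

Lemma gap_le y z a : psi y \is a fin_num -> psi z \is a fin_num ->
  (a%:E <= F z - F y)%E -> a <= gap z - gap y.
Proof.
move=> yfin zfin; rewrite /gap (objective_fin yfin) (objective_fin zfin).
rewrite (objective_fin (subdiff_fin ppsi opt)) -EFinN -EFinD lee_fin /=.
lra.
Qed.

Lemma gap_decr k : gap (x k.+1) <= gap (x k).
Proof.
have [[_ _ t2] xS _] := run_step k; rewrite -xS in t2.
have := gap_le (fin_x k.+1) (fin_x k) t2.
have : 0 <= beta * lam k * `|x k.+1 - x k| ^+ 2.
  by rewrite !mulr_ge0 ?(ltW (lam_gt0 _))//; case/andP: hb => /ltW.
lra.
Qed.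

Lemma small_gap z : `|z - xs| <= r -> psi z \is a fin_num ->
  gap z <= mu / 2 * delta ^+ 2 -> `|z - xs| <= delta.
Proof.
move=> zr zfin zgap; have := le_trans (quadratic_growth zr zfin) zgap.
by rewrite ler_pM2l ?divr_gt0// ler_pXn2r ?nnegrE ?(ltW basin_radius_gt0).
Qed.

(** Induction: a step may leave the basin, but F does not increase along it, and
    quadratic growth turns the bound on F back into membership. *)
Lemma run_basin k : `|x k - xs| <= delta /\ gap (x k) <= mu / 2 * delta ^+ 2.
Proof.
elim: k => [|k [xd xgap]].
  have [Lam [j [x0E g0E _ _]]] := run.
  have xgap : gap (x 0%N) <= mu / 2 * delta ^+ 2.
    rewrite x0E (le_trans (gradient_dominated x0r g0x0))//.
    rewrite ler_pdivrMr ?mulr_gt0//.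
    have : dual_norm (grad f x0 + g0) ^+ 2 <= (mu * delta) ^+ 2.
      rewrite ler_pXn2r ?nnegrE ?(ltW (mulr_gt0 mu0 basin_radius_gt0))//.
      by apply: dual_norm_ge0; apply: dualDf; [exact: grad_dual|exact: g0x0.1].
    by rewrite exprMn; lra.
  by split => //; apply: small_gap => //; rewrite x0E.
have [[adm _ _] xS _] := run_step k.
have [yr _] := basin_step (ltW (lam_gt0 k)) xd adm; rewrite -xS in yr.
have ygap := le_trans (gap_decr k) xgap.
by split => //; apply: small_gap.
Qed.

Let x_basin k : `|x k - xs| <= delta. Proof. by have [] := run_basin k. Qed.
Let x_r k : `|x k - xs| <= r. Proof. by have [] := basin_subW (x_basin k). Qed.

Lemma F_deriv_run k :
  F_deriv dot f H (lam k) (x k) (x k.+1) = grad f (x k.+1) + g k.+1.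
Proof. by have [_ _ ->] := run_step k. Qed.

(** Convexity and the first acceptance test bound the decrease from below by
    (alpha / lambda) |F'(x_(k+1))|^2, and gradient domination bounds that
    squared norm from below by 2 mu times the new gap. *)
Lemma gap_contraction k :
  (1 + 2 * alpha * mu / lam k) * gap (x k.+1) <= gap (x k).
Proof.
have [[adm t1 _] xS _] := run_step k.
have := basin_convex (x_basin k) (ltW (lam_gt0 k)) adm.
rewrite -xS in t1 *; rewrite F_deriv_run in t1 * => conv.
have := gap_le (a := (grad f (x k.+1) + g k.+1) (x k - x k.+1))
  (fin_x k.+1) (fin_x k).
have -> : (((grad f (x k.+1) + g k.+1) (x k - x k.+1))%:E
    <= F (x k) - F (x k.+1))%E.
  rewrite leeBrDr ?(addeC _ (F _))//.
  by rewrite /objective -(fineK (fin_x k.+1)).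
move=> /(_ isT) dec.
have gd := gradient_dominated (x_r k.+1) (run_subdiff k.+1).
have al : 0 < alpha / lam k by rewrite divr_gt0 ?lam_gt0//; case/andP: ha.
have : alpha / lam k * (2 * mu * gap (x k.+1)) <=
       alpha / lam k * dual_norm (grad f (x k.+1) + g k.+1) ^+ 2.
  rewrite ler_pM2l// mulrC -ler_pdivlMr ?mulr_gt0//.
by lra.
Qed.

Lemma gap_ge0 k : 0 <= gap (x k).
Proof.
apply: le_trans (quadratic_growth (x_r k) (fin_x k)).
by rewrite mulr_ge0// divr_ge0// ltW.
Qed.

Let residual y z := dual_norm (grad f y - grad f z - H z (y - z)).
Let xhalf k := xp (lam k / 2) (x k).

(** The trial value lam k.+1 / 2 is then at least 5 tau, as the acceptance of
    the half step requires. *)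
Lemma lam_halved_of_residual k tau :
  residual (xhalf k.+1) (x k.+1) <= tau * `|xhalf k.+1 - x k.+1| ->
  10 * tau <= lam k.+1 -> lam k.+1 = lam k / 2.
Proof.
move=> resid taul; apply: lam_halved.
apply: basin_accepted (x_basin _) _ (run_subdiff _) hxp ha _ resid _.
- by rewrite divr_gt0// lam_gt0.
- by case/andP: hb.
- by lra.
Qed.

Lemma xhalf_admissible k :
  admissible dot f psi H (lam k / 2) (x k) (xhalf k).
Proof.
have l0 : 0 <= lam k / 2 by rewrite divr_ge0// ltW// lam_gt0.
exact: basin_admissible (x_basin k) l0 (run_subdiff k) hxp.
Qed.

Lemma xhalf_r k : `|xhalf k - xs| <= r.
Proof.
have l0 : 0 <= lam k / 2 by rewrite divr_ge0// ltW// lam_gt0.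
by have [] := basin_step l0 (x_basin k) (xhalf_admissible k).
Qed.

Lemma lam_bounded k : lam k <= Num.max (lam 0%N) (10 * L).
Proof.
apply: halving_bounded lam_gt0 _ k => k Lk.
by apply: lam_halved_of_residual Lk; apply: lin_error; [exact: x_r|exact: xhalf_r].
Qed.

Lemma gap_cvg0 : gap \o x @ \oo --> (0 : R).
Proof.
set M := Num.max (lam 0%N) (10 * L).
have M0 : 0 < M by rewrite lt_max lam_gt0.
have a0 : 0 < alpha by case/andP: ha.
apply: (@contraction_cvg0 _ _ (2 * alpha * mu / M)) => [||k].
- by rewrite divr_gt0 ?mulr_gt0.
- exact: gap_ge0.
- apply: le_trans (gap_contraction k).
  rewrite ler_wpM2r ?gap_ge0// lerD2l ler_wpM2l ?mulr_ge0 ?(ltW mu0) ?(ltW a0)//.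
  by rewrite lef_pV2 ?posrE ?lam_gt0// lam_bounded.
Qed.

Lemma run_cvg : x @ \oo --> xs.
Proof.
apply/cvgrPdist_lt => d d0.
have c0 : 0 < mu / 2 * d ^+ 2 by rewrite mulr_gt0 ?divr_gt0 ?exprn_gt0.
near=> k.
have : gap (x k) < mu / 2 * d ^+ 2.
  by near: k; exact: cvgr_lt gap_cvg0 _ c0.
move=> /(le_lt_trans (quadratic_growth (x_r k) (fin_x k))).
by rewrite distrC ltr_pM2l ?divr_gt0// ltr_pXn2r// nnegrE// ltW.
Unshelve. all: by end_near. Qed.

Section Rates.
Hypothesis semismooth : semismooth_at f H xs.

Let err z := dual_norm (grad f z - grad f xs - H z (z - xs)).

Lemma semismooth_near (c : R) : 0 < c ->
  \forall z \near xs, err z <= c * `|z - xs|.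
Proof.
move=> c0; move: semismooth => /cvgrPdist_le/(_ _ c0).
rewrite near_withinE => /nbhs_ballP[d /= d0 dP].
apply/nbhs_ballP; exists d => // z; rewrite -ball_normE /= distrC => zd.
have [zs|zs] := eqVneq (z - xs) 0.
  have -> : z = xs by apply/subr0_eq.
  rewrite /err (subrr xs); have [dA _ _ sA] := hH xs.
  have -> : H xs 0 = 0 by apply/funext => v; rewrite sA (dual0 (dA v)).
  rewrite subrr subr0 normr0 mulr0; apply: dual_norm_le => //.
    by rewrite -(subrr (grad f xs)); apply: dualBf; exact: grad_dual.
  by move=> v; rewrite /= normr0 mul0r.
have := dP (z - xs); rewrite -ball_normE /= sub0r normrN => /(_ zd zs).
rewrite sub0r normrN (addrC xs) subrK.
have n0 : 0 < `|z - xs| by rewrite normr_gt0.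
rewrite ger0_norm ?ler_pdivrMr// divr_ge0// dual_norm_ge0//.
by apply: dualBf; [apply: dualBf; exact: grad_dual|exact: op_dual].
Qed.

Lemma semismooth_run (c : R) : 0 < c ->
  \forall k \near \oo, err (x k) <= c * `|x k - xs|.
Proof. by move=> c0; have := run_cvg (semismooth_near c0). Qed.

Lemma residual_of_quotient :
  residual (xhalf k) (x k) / `|xhalf k - x k| @[k --> \oo] --> (0 : R) ->
  forall c : R, 0 < c ->
  \forall k \near \oo, residual (xhalf k) (x k) <= c * `|xhalf k - x k|.
Proof.
move=> quot c c0; near=> k.
have : `|0 - residual (xhalf k) (x k) / `|xhalf k - x k| | <= c.
  by near: k; move/cvgrPdist_le: quot => /(_ _ c0).
have res0 : 0 <= residual (xhalf k) (x k).
  exact/dual_norm_ge0/newton_residual_dual.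
rewrite sub0r normrN ger0_norm ?divr_ge0//.
have [d0|dn0] := eqVneq (xhalf k - x k) 0; last by rewrite ler_pdivrMr ?normr_gt0.
move=> _; have := lin_error (x_r k) (xhalf_r k).
by rewrite /residual d0 normr0 !mulr0.
Unshelve. all: by end_near. Qed.

(** The residual between two points is the difference of their linearization
    errors at xs, up to the variation of the operators. Semismoothness bounds
    these errors by small multiples of the distances to xs. Both distances are
    at most a constant times the length of the half step: as lambda is bounded,
    the half step contracts the distance to xs by a factor bounded away
    from 1. *)
Lemma residual_of_operators :
  (fun k => dual_norm (H (xhalf k) (xhalf k - xs) - H (x k) (xhalf k - xs)))
    =o_\oo (fun k => `|xhalf k - x k|) ->
  forall c : R, 0 < c ->
  \forall k \near \oo, residual (xhalf k) (x k) <= c * `|xhalf k - x k|.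
Proof.
move=> /eqoP small c c0.
set M := Num.max (lam 0%N) (10 * L).
have M0 : 0 < M by rewrite lt_max lam_gt0.
pose C := 1 + M / mu; have C1 : 1 <= C by rewrite lerDl divr_ge0// ltW.
(* The bound mu / 2 makes the half step a contraction; the other one collects
   the constants of the final estimate. *)
pose s := Num.min (mu / 2) (c / (2 * C + 2)).
have s0 : 0 < s by rewrite lt_min !divr_gt0//; lra.
have smu : s <= mu / 2 by rewrite ge_min lexx.
have sc : s * (2 * C + 2) <= c.
  by rewrite -ler_pdivlMr ?ge_min ?lexx ?orbT//; lra.
have /nbhs_ballP[d /= d0 err_near] := semismooth_near s0.
near=> k.
have errk : err (x k) <= s * `|x k - xs| by near: k; exact: semismooth_run.
have xd : `|xs - x k| < d by near: k; apply: cvgr_dist_lt run_cvg _ d0.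
have opk : dual_norm (H (xhalf k) (xhalf k - xs) - H (x k) (xhalf k - xs))
    <= s * `|xhalf k - x k|.
  rewrite -[X in _ <= _ * X]normr_id; apply: le_trans (ler_norm _) _.
  by near: k; exact: small.
have l0 : 0 <= lam k / 2 by rewrite divr_ge0// ltW// lam_gt0.
have := newton_step_error hdot df ppsi hH l0 (coercive (x_r k)) opt
  (xhalf_admissible k).1.
rewrite -/(err _) => step.
have tri : `|x k - xs| <= `|xhalf k - xs| + `|xhalf k - x k|.
  by rewrite (distrC _ (x k)) -[x k - xs](subrKA (xhalf k)) addrC ler_normD.
have lM : lam k / 2 <= M / 2 by rewrite ler_pM2r// lam_bounded.
have hx : `|xhalf k - xs| <= `|x k - xs|.
  have ml : 0 < mu + lam k / 2 by rewrite ltr_wpDr.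
  rewrite -(ler_pM2l ml) (le_trans step)//.
  have : s * `|x k - xs| <= mu * `|x k - xs| by rewrite ler_wpM2r//; lra.
  lra.
have errh : err (xhalf k) <= s * `|xhalf k - xs|.
  by apply: err_near; rewrite -ball_normE /= distrC (le_lt_trans hx)// distrC.
have hC : `|xhalf k - xs| <= C * `|xhalf k - x k|.
  have m2 : 0 < mu / 2 by rewrite divr_gt0.
  rewrite -(ler_pM2l m2).
  have -> : mu / 2 * (C * `|xhalf k - x k|) =
      (mu / 2 + M / 2) * `|xhalf k - x k|.
    by rewrite /C; field; rewrite gt_eqF.
  have : s * `|x k - xs| <= mu / 2 * `|x k - xs| by rewrite ler_wpM2r.
  have : (mu / 2 + lam k / 2) * `|x k - xs| <=
      (mu / 2 + lam k / 2) * (`|xhalf k - xs| + `|xhalf k - x k|).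
    by rewrite ler_wpM2l// addr_ge0// ltW.
  have : lam k / 2 * `|xhalf k - x k| <= M / 2 * `|xhalf k - x k|.
    by rewrite ler_wpM2r.
  lra.
have errE : residual (xhalf k) (x k) <= err (xhalf k) + err (x k) +
    dual_norm (H (xhalf k) (xhalf k - xs) - H (x k) (xhalf k - xs)).
  have derr z : dual (grad f z - grad f xs - H z (z - xs)).
    by apply: dualBf; [apply: dualBf; exact: grad_dual|exact: op_dual].
  have dH : dual (H (xhalf k) (xhalf k - xs) - H (x k) (xhalf k - xs)).
    by apply: dualBf; exact: op_dual.
  apply: le_trans (lerD (dual_normB (derr (xhalf k)) (derr (x k))) (lexx _)).
  apply: le_trans (dual_normD (dualBf (derr _) (derr _)) dH).
  rewrite le_eqVlt; apply/predU1P; left; congr dual_norm; apply/funext => v.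
  have -> : xhalf k - x k = (xhalf k - xs) + - (x k - xs).
    by rewrite opprB addrA subrK.
  by rewrite !fctE (opDl _ _ _ (hH _)) (opNl _ _ (hH _)); ring.
have n0 : 0 <= `|xhalf k - x k| by [].
have : s * (`|xhalf k - xs| + `|x k - xs| + `|xhalf k - x k|) <=
    s * ((2 * C + 2) * `|xhalf k - x k|) by rewrite ler_pM2l//; lra.
have : s * (2 * C + 2) * `|xhalf k - x k| <= c * `|xhalf k - x k|.
  by rewrite ler_wpM2r.
lra.
Unshelve. all: by end_near. Qed.

Hypothesis residual_small : forall c : R, 0 < c ->
  \forall k \near \oo, residual (xhalf k) (x k) <= c * `|xhalf k - x k|.

Lemma lam_cvg0 : lam @ \oo --> (0 : R).
Proof.
apply: halving_cvg0 lam_gt0 _ => c c0.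
have [N _ resid] := residual_small (divr_gt0 c0 (ltr0Sn _ 9)).
exists N => // k /= Nk ck; apply: lam_halved_of_residual (resid k.+1 _) _.
  exact: leqW.
by lra.
Qed.

Lemma distance_superlinear : superlinear (fun k => `|x k - xs|).
Proof.
exists (fun k => (err (x k) / `|x k - xs| + lam k) / mu); split.
  rewrite -(mul0r mu^-1); apply: cvgM; last exact: cvg_cst.
  rewrite -[X in _ --> X]addr0; apply: cvgD lam_cvg0.
  apply/cvgrPdist_le => c c0; near=> k.
  have errk : err (x k) <= c * `|x k - xs| by near: k; exact: semismooth_run.
  have err0 : 0 <= err (x k).
    by apply: dual_norm_ge0; apply: dualBf; [apply: dualBf; exact: grad_dual|exact: op_dual].
  rewrite sub0r normrN ger0_norm ?divr_ge0//.
  have [->|xk] := eqVneq (x k) xs; first by rewrite subrr normr0 invr0 mulr0 ltW.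
  by rewrite ler_pdivrMr// normr_gt0 subr_eq0.
near=> k.
have [[adm _ _] xS _] := run_step k.
have := newton_step_error hdot df ppsi hH (ltW (lam_gt0 k)) (coercive (x_r k)) opt adm.1.
rewrite -xS -/(err _) => step.
have errk : err (x k) = err (x k) / `|x k - xs| * `|x k - xs|.
  have errk : err (x k) <= 1 * `|x k - xs| by near: k; exact: semismooth_run.
  have err0 : 0 <= err (x k).
    by apply: dual_norm_ge0; apply: dualBf; [apply: dualBf; exact: grad_dual|exact: op_dual].
  have [xk|xk] := eqVneq (x k) xs; last by rewrite divfK// normr_eq0 subr_eq0.
  move: errk; rewrite xk subrr normr0 mulr0 -xk => errk.
  by rewrite mulr0; apply/le_anti; rewrite errk.
rewrite mulrAC ler_pdivlMr// mulrDl -errk (le_trans _ step)//.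
by rewrite mulrC ler_wpM2r// lerDl ltW// lam_gt0.
Unshelve. all: by end_near. Qed.

Lemma gap_superlinear : superlinear (gap \o x).
Proof.
have a0 : 0 < alpha by case/andP: ha.
have am : 0 < 2 * alpha * mu by rewrite !mulr_gt0.
exists (fun k => lam k / (2 * alpha * mu)); split.
  by rewrite -(mul0r (2 * alpha * mu)^-1); apply: cvgM lam_cvg0 (cvg_cst _).
near=> k; rewrite /= mulrAC ler_pdivlMr//.
have l0 := lam_gt0 k; have := gap_contraction k; have := gap_ge0 k.+1.
rewrite -(ler_pM2l l0) => gS; rewrite -(ler_pM2l l0).
have -> : lam k * ((1 + 2 * alpha * mu / lam k) * gap (x k.+1)) =
  lam k * gap (x k.+1) + 2 * alpha * mu * gap (x k.+1).
  by field; rewrite gt_eqF.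
rewrite mulr0 in gS; lra.
Unshelve. all: by end_near. Qed.

Lemma gradient_superlinear : superlinear G.
Proof.
have a0 : 0 < alpha by case/andP: ha.
have am : 0 < alpha * mu by rewrite mulr_gt0.
exists (fun k => lam k / (alpha * mu)); split.
  by rewrite -(mul0r (alpha * mu)^-1); apply: cvgM lam_cvg0 (cvg_cst _).
near=> k; have [[adm t1 _] xS _] := run_step k; have l0 := lam_gt0 k.
have := newton_step_le hdot df ppsi (coercive (x_r k)) (run_subdiff k) adm.1.
move: t1; rewrite -xS F_deriv_run -/(G _) => t1 step.
have hg : dual (grad f (x k.+1) + g k.+1).
  by apply: dualDf; [exact: grad_dual|exact: (run_subdiff _).1].
have Gle : alpha / lam k * G k.+1 <= `|x k.+1 - x k|.
  apply: mul_sqr_le => //; first exact: dual_norm_ge0.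
  rewrite (le_trans t1)// (le_trans (ler_norm _))// mulrC distrC.
  exact: dual_norm_ge.
have muG : mu * `|x k.+1 - x k| <= G k.
  by apply: le_trans step; rewrite ler_wpM2r// lerDl ltW.
have : mu * (alpha / lam k * G k.+1) <= G k.
  by apply: le_trans muG; rewrite ler_wpM2l// ltW.
rewrite [X in _ -> _ <= X]mulrAC ler_pdivlMr// => GG.
have := GG; rewrite -(ler_pM2l l0).
suff -> : lam k * (mu * (alpha / lam k * G k.+1)) = G k.+1 * (alpha * mu) by [].
by field; rewrite gt_eqF.
Unshelve. all: by end_near. Qed.

End Rates.

Lemma local_superlinear_convergence : semismooth_at f H xs ->
  (fun k => dual_norm (H (xhalf k) (xhalf k - xs) - H (x k) (xhalf k - xs)))
    =o_\oo (fun k => `|xhalf k - x k|) \/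
  residual (xhalf k) (x k) / `|xhalf k - x k| @[k --> \oo] --> (0 : R) ->
  [/\ superlinear (fun k => `|x k - xs|), superlinear (gap \o x)
    & superlinear G].
Proof.
move=> ss small.
have res_small : forall c : R, 0 < c ->
    \forall k \near \oo, residual (xhalf k) (x k) <= c * `|xhalf k - x k|.
  by case: small => [/residual_of_operators|/residual_of_quotient]; exact.
split; [exact: distance_superlinear|exact: gap_superlinear|].
exact: gradient_superlinear.
Qed.

End Iterates.
End LocalConvergence.

(** * Superlinear convergence *)

Theorem theorem6p9 (R : realType) (V : completeNormedModType R)
  (dot : {dot V for @idfun R}) (hdot : hilbert_dot dot)
  (f : V -> R) (hf : C11 f)
  (psi : V -> \bar R) (psi_proper : proper_fun psi)
  (psi_convex : convex_on setT psi) (psi_lsc : lower_semicontinuous psi)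
  (F : V -> \bar R) (hF : F = objective f psi)
  (F_bounded_below : exists c : R, forall x, (c%:E <= F x)%E)
  (S : set V) (hS : S = argmin F) (S_nonempty : S !=set0)
  (H : V -> V -> V -> R) (hH : forall x, sym_bounded_op (H x))
  (xs : V) (xs_min : isolated_local_minimizer F xs)
  (r : R) (r_gt0 : 0 < r)
  (B : set V) (hB : B = closed_ball xs r)
  (hr : forall x, B x -> (F xs <= F x)%E /\ dist_set x S = `|x - xs|)
  (L mu : R) (L_ge0 : 0 <= L) (mu_gt0 : 0 < mu)
  (h1 : forall x y, B x -> B y ->
     dual_norm (grad f y - grad f x - H x (y - x)) <= L * `|x - y|)
  (h1' : subproblem_assumption dot f psi H L)
  (h2 : forall x, B x ->
     (F x - F xs <= ((2 * mu)^-1)%:E * dist0_subdiffF f psi x ^+ 2)%E)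
  (h3 : forall x, B x -> forall d, mu * `|d| ^+ 2 <= H x d d)
  (h4 : forall x, B x -> ((mu / 2 * dist_set x S ^+ 2)%:E <= F x - F xs)%E)
  (F_convex_near : exists2 e : R, 0 < e & convex_on (ball xs e) F)
  (f_semismooth : semismooth_at f H xs) :
  exists2 Delta : R, 0 < Delta &
  forall (m alpha beta Lam0 : R),
    1 <= m -> 0 < alpha <= 2^-1 -> 0 < beta <= (m - 1) / (2 * m) -> 0 < Lam0 ->
  forall (xp : R -> V -> V), solution_map dot f psi H xp ->
  forall (x0 : V) (g0 : V -> R),
    edom F x0 -> subdiff psi x0 g0 ->
    B x0 -> dual_norm (grad f x0 + g0) <= Delta ->
  forall (x : nat -> V) (g : nat -> V -> R) (lam : nat -> R),
    leap_ssn_iterates dot f psi H alpha beta Lam0 xp x0 g0 x g lam ->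
  let xhalf k := xp (lam k / 2) (x k) in
    (fun k => dual_norm (H (xhalf k) (xhalf k - xs) - H (x k) (xhalf k - xs)))
      =o_\oo (fun k => `|xhalf k - x k|)
    \/
    dual_norm (grad f (xhalf k) - grad f (x k) - H (x k) (xhalf k - x k))
      / `|xhalf k - x k| @[k --> \oo] --> (0 : R) ->
  [/\ superlinear (fun k => `|x k - xs|),
      superlinear (fun k => fine (F (x k) - F xs)%E)
    & superlinear (fun k => dual_norm (grad f (x k) + g k))].
Proof.
subst F S B; set F := objective f psi in xs_min hr h2 h4 *.
have df := hf.1; have psiNy := psi_proper.1.
have Bin x : `|x - xs| <= r -> closed_ball xs r x.
  by rewrite closed_ballE// /closed_ball_ /= distrC.
have xs_fin : (psi xs < +oo)%E.
  by have := xs_min.1.1; rewrite /F /objective; case: (psi xs) (psiNy xs).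
have opt : subdiff psi xs (- grad f xs).
  apply: fermat_composite psi_proper psi_convex _ _ xs_fin xs_min.1.2.
    exact: grad_dual.
  exact: differentiable_ray.
have lin_error x y : `|x - xs| <= r -> `|y - xs| <= r ->
    dual_norm (grad f y - grad f x - H x (y - x)) <= L * `|y - x|.
  by move=> xr yr; rewrite distrC; exact: h1 (Bin _ xr) (Bin _ yr).
have coer x : `|x - xs| <= r -> forall d, mu * `|d| ^+ 2 <= H x d d.
  by move=> xr; exact: h3 (Bin _ xr).
have FE x : psi x \is a fin_num -> (F x - F xs)%E = (fine (F x - F xs)%E)%:E.
  move=> xfin; rewrite /F (objective_fin f xfin).
  by rewrite (objective_fin f (subdiff_fin psi_proper opt)).
have grad_dom x g : `|x - xs| <= r -> subdiff psi x g ->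
    fine (F x - F xs)%E <= dual_norm (grad f x + g) ^+ 2 / (2 * mu).
  move=> xr gx; have := h2 _ (Bin _ xr).
  rewrite FE ?(subdiff_fin psi_proper gx)// => le.
  have dg : dual (grad f x + g) by apply: dualDf; [exact: grad_dual|exact: gx.1].
  have sqrE : dual_norm (grad f x + g) ^+ 2 / (2 * mu) =
      (2 * mu)^-1 * dual_norm (grad f x + g) ^+ 2 by rewrite mulrC.
  rewrite -lee_fin (le_trans le)// sqrE EFinM lee_pmul2l//; last first.
    by rewrite lte_fin invr_gt0 mulr_gt0.
  have dist0 : (0 <= dist0_subdiffF f psi x)%E.
    apply: le_ereal_inf_tmp => _ [_ [p px <-] <-]; rewrite lee_fin.
    by apply: dual_norm_ge0; apply: dualDf; [exact: grad_dual|exact: px.1].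
  have distle : (dist0_subdiffF f psi x <= (dual_norm (grad f x + g))%:E)%E.
    by apply: ereal_inf_lbound; exists (grad f x + g) => //; exists g.
  by rewrite EFin_expe !expe2 lee_pmul.
have growth x : `|x - xs| <= r -> psi x \is a fin_num ->
    mu / 2 * `|x - xs| ^+ 2 <= fine (F x - F xs)%E.
  move=> xr xfin; have := h4 _ (Bin _ xr).
  by rewrite (hr _ (Bin _ xr)).2 FE// lee_fin.
have [e e0 convF] := F_convex_near.
pose delta := basin_radius r e L mu.
exists (mu * delta).
  by rewrite mulr_gt0// basin_radius_gt0.
move=> m alpha beta Lam0 m1 ha hb Lam00 xp hxp x0 g0 x0F gx0 x0B x0small
  x g lam run xhalf small.
have x0r : `|x0 - xs| <= r.
  by move: x0B; rewrite closed_ballE// /closed_ball_ /= distrC.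
have hb' : 0 < beta <= 2^-1.
  case/andP: hb => -> /= /le_trans; apply.
  rewrite ler_pdivrMr; last by rewrite mulr_gt0// (lt_le_trans ltr01).
  lra.
exact: (local_superlinear_convergence hdot df psi_proper psi_convex psi_lsc hH
  r_gt0 e0 L_ge0 mu_gt0 opt lin_error coer grad_dom growth convF ha hb' Lam00
  hxp gx0 x0r x0small run f_semismooth small).
Qed.
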